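(* For each integer $d\ge1$, let $L_d^{\mathrm{idim}}=\{w\in\{0,1\}^*\mid |w|_0=|w|_1=2d,\ \exists x\in\{0011,1100\}\ \forall k\in\{1,\dots,d\}:\ \delta_{k,k}^{2d}(w)=x\}$. Then $L_d^{\mathrm{idim}}$ is $2d$-uniform and $\mathcal{G}_{L_d^{\mathrm{idim}}}$ is exactly the class of comparability graphs of posets of interval dimension at most $d$.
   Context: $|w|_a$ is the number of occurrences of letter $a$ in $w$; a binary word is $k$-uniform if it has exactly $k$ occurrences of $0$ and of $1$. For a $2d$-uniform binary word $w$ and $k\in\{1,\dots,d\}$, $\delta_{k,k}^{2d}(w)$ keeps only the $(2k-1)$-st and $2k$-th occurrences of $0$ and of $1$, deleting all other letters. For a word $w$ and distinct letters $a,b$, $h_{a,b}(w)$ replaces $a$ by $0$, $b$ by $1$ and deletes other letters. For $L\subseteq\{0,1\}^*$ closed under exchanging $0$ and $1$ and a word $w$ with letter set $V$, $G(L,w)$ is the graph on $V$ where distinct $u,v$ are adjacent iff $h_{u,v}(w)\in L$; $\mathcal{G}_L$ is the class of graphs isomorphic to some $G(L,w)$. An interval order is a partial order whose elements $x$ can be assigned closed real intervals $I_x$ such that $x\prec y$ iff $I_x$ lies entirely to the left of $I_y$. The interval dimension of a poset is the smallest number of interval orders whose intersection is the poset. The comparability graph of a poset joins two distinct elements iff they are comparable. *)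

(* Defs.v *)
From HB Require Import structures.
From mathcomp Require Import all_boot all_order all_algebra.
From mathcomp Require Import reals.

Set Implicit Arguments.
Unset Strict Implicit.
Unset Printing Implicit Defensive.

Import Order.TTheory.

Record sgraph := SGraph {
  vertex :> finType;
  adj : rel vertex;
  adj_sym : symmetric adj;
  adj_irrefl : irreflexive adj }.

Definition giso (G H : sgraph) : Prop :=
  exists2 f : G -> H, bijective f & {mono f : x y / adj x y}.

(* Binary words are [seq bool], with [false] for the letter 0 and [true] for 1. *)
Notation bword := (seq bool).

Definition uniform (k : nat) (w : bword) : bool :=
  (count_mem false w == k) && (count_mem true w == k).

Definition uniform_lang (k : nat) (L : pred bword) : Prop :=
  forall w, w \in L -> uniform k w.

Record swap_lang := SwapLang {
  lang :> pred bword;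
  lang_swap : forall w, (map negb w \in lang) = (w \in lang) }.

Definition h_proj (A : eqType) (a b : A) (w : seq A) : bword :=
  [seq x == b | x <- w & (x == a) || (x == b)].

Lemma h_proj_swap (A : eqType) (a b : A) (w : seq A) :
  a != b -> h_proj b a w = map negb (h_proj a b w).
Proof.
move=> ab; rewrite /h_proj -map_comp.
rewrite (eq_filter (a2 := fun x => (x == a) || (x == b))); last first.
  by move=> x; rewrite orbC.
apply/eq_in_map => x; rewrite mem_filter /= => /andP[/orP[]/eqP-> _].
  by rewrite eqxx (negbTE ab).
by rewrite eqxx eq_sym (negbTE ab).
Qed.

Section WordGraph.
Variables (L : swap_lang) (A : finType) (w : seq A).

(* [seq_sub w] is the finite type of the letters occurring in [w]. *)
Definition word_adj : rel (seq_sub w) :=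
  fun u v => (u != v) && (h_proj (val u) (val v) w \in lang L).

Lemma word_adj_sym : symmetric word_adj.
Proof.
move=> u v; rewrite /word_adj eq_sym; case: eqVneq => //= uv.
by rewrite [in RHS]h_proj_swap ?lang_swap // val_eqE eq_sym.
Qed.

Lemma word_adj_irrefl : irreflexive word_adj.
Proof. by move=> u; rewrite /word_adj eqxx. Qed.

Definition word_graph : sgraph := SGraph word_adj_sym word_adj_irrefl.

End WordGraph.

Definition graph_class (L : swap_lang) (G : sgraph) : Prop :=
  exists (A : finType) (w : seq A), giso G (word_graph L w).

(* The (1-based) rank of position [i] of [w] among the occurrences of the same *)
(* letter.                                                                     *)
Definition occ (w : bword) (i : nat) : nat :=
  count_mem (nth false w i) (take i.+1 w).

Definition delta (k : nat) (w : bword) : bword :=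
  mask [seq occ w i \in [:: (2 * k).-1; 2 * k] | i <- iota 0 (size w)] w.

Definition w0011 : bword := [:: false; false; true; true].
Definition w1100 : bword := [:: true; true; false; false].

Definition idim_pred (d : nat) : pred bword := fun w =>
  [&& count_mem false w == 2 * d, count_mem true w == 2 * d &
      has (fun x => all (fun k => delta k w == x) (iota 1 d)) [:: w0011; w1100]].

Lemma count_mem_negb b w : count_mem b (map negb w) = count_mem (~~ b) w.
Proof. by rewrite count_map; apply: eq_count => -[]; case: b. Qed.

Lemma delta_negb k w : delta k (map negb w) = map negb (delta k w).
Proof.
rewrite /delta map_mask size_map; congr mask.
apply/eq_in_map => i; rewrite mem_iota /= add0n => lt_iw.
by rewrite /occ (nth_map false) // -map_take count_mem_negb negbK.
Qed.

Lemma idim_pred_swap d w : (map negb w \in idim_pred d) = (w \in idim_pred d).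
Proof.
have E x : all (fun k => delta k (map negb w) == x) (iota 1 d) =
           all (fun k => delta k w == map negb x) (iota 1 d).
  apply: eq_all => k; rewrite delta_negb -(inj_eq (inj_map negb_inj)).
  by rewrite -map_comp (eq_map (g := id)) ?map_id // => b /=; rewrite negbK.
rewrite !unfold_in /idim_pred !count_mem_negb /= !E /= !orbF.
by rewrite andbCA [X in _ && (_ && X)]orbC.
Qed.

Definition L_idim (d : nat) : swap_lang := SwapLang (@idim_pred_swap d).

Section IntervalDimension.
Variable R : realType.
Local Open Scope ring_scope.

Definition left_of (I J : interval R) : Prop :=
  forall a b : R, a \in I -> b \in J -> a < b.

(* [e] is the strict part of the order. *)
Definition interval_order (T : finType) (e : rel T) : Prop :=
  [/\ irreflexive e, transitive e &
      exists2 lr : T -> R * R, (forall x, (lr x).1 <= (lr x).2) &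
        forall x y, e x y <->
          left_of `[(lr x).1, (lr x).2] `[(lr y).1, (lr y).2]].

Definition interval_realizer disp (P : finPOrderType disp) (n : nat)
    (e : 'I_n -> rel P) : Prop :=
  (forall i, interval_order (e i)) /\
  (forall x y : P, (x < y)%O <-> forall i, e i x y).

Definition is_interval_dim disp (P : finPOrderType disp) (n : nat) : Prop :=
  (exists e : 'I_n -> rel P, interval_realizer e) /\
  (forall m (e : 'I_m -> rel P), interval_realizer e -> (n <= m)%N).

Definition interval_dim_le disp (P : finPOrderType disp) (d : nat) : Prop :=
  exists2 n, is_interval_dim P n & (n <= d)%N.

End IntervalDimension.

Section Comparability.
Variables (disp : Order.disp_t) (P : finPOrderType disp).

Definition cmp_adj : rel P := fun x y => (x != y) && (x >=< y)%O.

Lemma cmp_adj_sym : symmetric cmp_adj.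
Proof. by move=> x y; rewrite /cmp_adj eq_sym comparable_sym. Qed.

Lemma cmp_adj_irrefl : irreflexive cmp_adj.
Proof. by move=> x; rewrite /cmp_adj eqxx. Qed.

Definition comparability_graph : sgraph := SGraph cmp_adj_sym cmp_adj_irrefl.

End Comparability.

(* Main.v *)
Require Import Defs.
From HB Require Import structures.
From mathcomp Require Import all_boot all_order all_algebra.
From mathcomp Require Import zify boolp reals.

Set Implicit Arguments.
Unset Strict Implicit.
Unset Printing Implicit Defensive.

Import Order.TTheory GRing.Theory Num.Theory.

(** The [k]-th pair of occurrences of a letter in a word is an interval of
    positions, and [delta k] of the projection to two letters is [0011] or [1100]
    exactly when their [k]-th intervals are disjoint, in one order or the other.
    This is detected by a prefix containing [2k] occurrences of one letter and at
    most [2k-2] of the other, a criterion insensitive to deleting further letters.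
    A word thus yields [d] interval orders whose intersection has the word graph as
    comparability graph. Conversely, listing the endpoints of the intervals of
    [d] interval orders from left to right and concatenating the [d] lists gives a
    word in which the [k]-th block carries the [k]-th pairs of occurrences. *)

(** * Prefixes and letter counts of [delta] *)

Lemma delta_rcons k w b :
  delta k (rcons w b) =
  delta k w ++
    (if (count_mem b w).+1 \in [:: (2 * k).-1; 2 * k] then [:: b] else [::]).
Proof.
rewrite /delta size_rcons -[(size w).+1]addn1 iotaD add0n map_cat -!cats1 mask_cat; last first.
  by rewrite size_map size_iota.
congr (_ ++ _).
  congr (mask _ w); apply/eq_in_map => i; rewrite mem_iota add0n /= => lt_iw.
  by rewrite /occ nth_cat lt_iw takel_cat.
rewrite /= /occ nth_cat ltnn subnn /= take_oversize ?size_cat ?addn1 //.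
by rewrite count_cat /= eqxx addn1; case: ifP => // ->.
Qed.

Lemma count_delta k b w :
  count_mem b (delta k.+1 w) = minn (count_mem b w - 2 * k) 2.
Proof.
elim/last_ind: w => [|w c IH] //; rewrite delta_rcons count_cat IH -cats1 count_cat.
rewrite !inE /=; case: (eqVneq c b) => [->|cb]; case: ifP => /=;
  rewrite ?eqxx ?(negbTE cb); lia.
Qed.

Lemma delta_cat k u v : exists s, delta k (u ++ v) = delta k u ++ s.
Proof.
elim/last_ind: v => [|v b [s IH]]; first by exists [::]; rewrite !cats0.
by rewrite -rcons_cat delta_rcons IH -catA; eexists.
Qed.

(** Appending a letter to a word lengthens its [delta] by at most one letter, so along the prefixes
    of [w] every prefix of [delta k w] is attained. *)
Lemma delta_eq_cat k w x y :
  delta k w = x ++ y -> exists i, delta k (take i w) = x.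
Proof.
elim/last_ind: w y => [|w b IH] y; first by case: x => // _; exists 0.
case/lastP: y => [|y' c]; first
  by rewrite cats0 => H; exists (size w).+1; rewrite take_oversize ?size_rcons.
(* A cut beyond the end of [w] would pick up the new letter, hence the minimum. *)
have lift i : exists j, take j (rcons w b) = take i w.
  exists (minn i (size w)); rewrite -cats1 takel_cat ?geq_minr //.
  by case: (leqP i (size w)) => // /ltnW le_wi; rewrite take_size take_oversize.
have {}IH y1 : delta k w = x ++ y1 -> exists i, delta k (take i (rcons w b)) = x.
  by move=> /IH[i <-]; have [j <-] := lift i; exists j.
rewrite delta_rcons; case: ifP => _; last by rewrite cats0; apply: IH.
by rewrite cats1 -rcons_cat => /rcons_inj[] /IH.
Qed.

Lemma seq_bool_count0 b (w : bword) :
  count_mem (~~ b) w = 0 -> w = nseq (count_mem b w) b.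
Proof. by elim: w => //= c w IH; case: c; case: b IH => //= IH; rewrite ?add0n ?add1n // => /IH <-. Qed.

(** The criterion says that some prefix has [delta] equal to 00. Given such a prefix, the counts
    leave exactly two letters 1 for the rest, and a constant word is determined by its count. *)
Lemma delta_eq_w0011 k w :
    2 * k.+1 <= count_mem false w -> 2 * k.+1 <= count_mem true w ->
  delta k.+1 w = w0011 <->
  exists i, 2 * k.+1 <= count_mem false (take i w) /\
            count_mem true (take i w) <= 2 * k.
Proof.
move=> w0 w1; split=> [/(delta_eq_cat (x := [:: false; false]))[i Ei]|[i [i0 i1]]].
  by exists i; move: (count_delta k false (take i w)) (count_delta k true (take i w)); rewrite Ei /=; lia.
have [s Es] := delta_cat k.+1 (take i w) (drop i w); rewrite cat_take_drop in Es.
move: (count_delta k false (take i w)) (count_delta k true (take i w)).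
move: (count_delta k false w) (count_delta k true w).
rewrite Es !count_cat => c0 c1 d0 d1.
have t0 : count_mem false (delta k.+1 (take i w)) = 2 by lia.
have t1 : count_mem true (delta k.+1 (take i w)) = 0 by lia.
have s0 : count_mem false s = 0 by lia.
have s1 : count_mem true s = 2 by lia.
by rewrite (@seq_bool_count0 false _ t1) (@seq_bool_count0 true _ s0) t0 s1.
Qed.

(** * Projection to two letters and its prefixes *)

Section Projection.
Variables (A : eqType) (a b : A).
Hypothesis ab : a != b.

Lemma count_h_proj w :
  (count_mem false (h_proj a b w) = count_mem a w) *
  (count_mem true (h_proj a b w) = count_mem b w).
Proof.
elim: w => //= x w [IH0 IH1]; rewrite /h_proj /=.
case: (eqVneq x a) => [->|xa] /=; first by rewrite (negbTE ab) /= IH0 IH1.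
by case: (eqVneq x b) => //= xb; rewrite ?xb ?eqxx /= IH0 IH1.
Qed.

Lemma h_proj_take i w : exists j, h_proj a b (take i w) = take j (h_proj a b w).
Proof.
exists (size (h_proj a b (take i w))).
by rewrite -[in h_proj a b w](cat_take_drop i w) /h_proj filter_cat map_cat take_size_cat.
Qed.

Lemma take_h_proj j w : exists i, take j (h_proj a b w) = h_proj a b (take i w).
Proof.
elim: w j => [|x w IH] j; first by exists 0.
rewrite /h_proj /=; case E: (_ || _) => /=.
  case: j => [|j]; first by exists 0.
  by have [i Ei] := IH j; exists i.+1; rewrite /= E /= -[in RHS]/(h_proj _ _ _) -Ei.
by have [i Ei] := IH j; exists i.+1; rewrite /= E -[RHS]/(h_proj _ _ _) -Ei.
Qed.

End Projection.

(* The occurrences of [a] of ranks [2k+1] and [2k+2] both come before the      *)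
(* occurrence of [b] of rank [2k+1].                                           *)
Definition precedes (A : eqType) (k : nat) (a b : A) (w : seq A) : Prop :=
  exists i, 2 * k.+1 <= count_mem a (take i w) /\ count_mem b (take i w) <= 2 * k.

(** * Membership in the language in terms of [precedes] *)

Section Language.
Variables (A : eqType) (d : nat).
Implicit Types (a b : A) (w : seq A).

Lemma delta_h_proj k a b w : a != b ->
    2 * k.+1 <= count_mem a w -> 2 * k.+1 <= count_mem b w ->
  (delta k.+1 (h_proj a b w) = w0011 <-> precedes k a b w) *
  (delta k.+1 (h_proj a b w) = w1100 <-> precedes k b a w).
Proof.
have main a' b' : a' != b' -> 2 * k.+1 <= count_mem a' w -> 2 * k.+1 <= count_mem b' w ->
    delta k.+1 (h_proj a' b' w) = w0011 <-> precedes k a' b' w.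
  move=> ab wa wb; rewrite delta_eq_w0011 ?count_h_proj //.
  split=> [] [i]; [have [j ->] := take_h_proj a' b' i w|have [j] := h_proj_take a' b' i w => E].
    by rewrite !count_h_proj //; exists j.
  by move=> H; exists j; rewrite -E !count_h_proj.
move=> ab wa wb; split; first exact: main.
rewrite -main // 1?eq_sym // [h_proj b a w]h_proj_swap // delta_negb.
rewrite -[w0011]/(map negb w1100); split=> [->//|]; exact/inj_map/negb_inj.
Qed.

Lemma h_proj_L_idim a b w : a != b ->
  h_proj a b w \in lang (L_idim d) <->
  [/\ count_mem a w = 2 * d, count_mem b w = 2 * d &
      (forall k, k < d -> precedes k a b w) \/ (forall k, k < d -> precedes k b a w)].
Proof.
move=> ab; rewrite unfold_in /= /idim_pred !count_h_proj // orbF.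
have allE x : all (fun k => delta k (h_proj a b w) == x) (iota 1 d) <->
    forall k, k < d -> delta k.+1 (h_proj a b w) = x.
  split=> [/allP H k kd|H]; first by apply/eqP/H; rewrite mem_iota; lia.
  by apply/allP => -[|k]; rewrite mem_iota // => ?; apply/eqP/H; lia.
have delta_iff k (kd : k < d) (wa : count_mem a w = 2 * d) (wb : count_mem b w = 2 * d) :
    (delta k.+1 (h_proj a b w) = w0011 <-> precedes k a b w) *
    (delta k.+1 (h_proj a b w) = w1100 <-> precedes k b a w).
  by apply: delta_h_proj; rewrite ?wa ?wb //; lia.
split=> [/and3P[/eqP wa /eqP wb H]|[wa wb H]].
  split=> //; case/orP: H => /allE H; [left|right] => k kd.
    by apply/(delta_iff k kd wa wb).1/H.
  by apply/(delta_iff k kd wa wb).2/H.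
rewrite wa wb eqxx; case: H => H; apply/orP; [left|right]; apply/allE => k kd.
  by apply/(delta_iff k kd wa wb).1/H.
by apply/(delta_iff k kd wa wb).2/H.
Qed.

End Language.

(** * Interval orders and realizers *)

Section IntervalOrders.
Variables (R : realType).
Local Open Scope ring_scope.

Lemma left_ofE (a b c d : R) : a <= b -> c <= d ->
  left_of `[a, b] `[c, d] <-> b < c.
Proof.
move=> ab cd; split=> [|bc x y]; first by apply; rewrite in_itv /= ?lexx ?ab ?cd.
by rewrite !in_itv /= => /andP[_ xb] /andP[cy _]; apply: le_lt_trans xb (lt_le_trans bc cy).
Qed.

Lemma interval_order_nat (T : finType) (l r : T -> nat) :
  (forall x, (l x <= r x)%N) -> interval_order R (fun x y => (r x < l y)%N).
Proof.
move=> lr; split=> [x|y x z rl1 rl2|].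
- by rewrite ltnNge lr.
- by apply: leq_trans rl1 (leq_trans (lr y) (ltnW rl2)).
exists (fun x => ((l x)%:R, (r x)%:R)) => [x|x y] /=; first by rewrite ler_nat.
by rewrite left_ofE ?ler_nat // ltr_nat.
Qed.

(** The dimension is a least size, so it is obtained by well-ordering; [asbool] makes the existence
    of a realizer a boolean predicate. *)
Lemma interval_dim_le_realizer disp (P : finPOrderType disp) d
    (e : 'I_d -> rel P) : interval_realizer R e -> interval_dim_le R P d.
Proof.
move=> He; pose Q n := `[< exists e : 'I_n -> rel P, interval_realizer R e >].
have exQ : exists n, Q n by exists d; apply/asboolP; exists e.
case: (ex_minnP exQ) => n /asboolP Qn min_n; exists n.
  by split=> // m f Hf; apply: min_n; apply/asboolP; exists f.
by apply: min_n; apply/asboolP; exists e.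
Qed.

(* Repeating members pads a realizer to size [d]; only the empty poset has a   *)
(* realizer of size [0], and for it there is nothing to check.                 *)
Lemma interval_dim_le_endpoints disp (P : finPOrderType disp) d :
  interval_dim_le R P d ->
  exists lr : nat -> P -> R * R, (forall k x, (lr k x).1 <= (lr k x).2) /\
    forall x y, (x < y)%O <-> forall k, (k < d)%N -> (lr k x).2 < (lr k y).1.
Proof.
case=> -[|n] [[e [He ltE]] _] nd.
  have P0 (x : P) : False.
    by suff: (x < x)%O; [rewrite ltxx|apply/ltE => -[]].
  by exists (fun _ _ => (0, 0)); split=> // x; have := P0 x.
have /choice[lr Hlr] : forall i, exists lr : P -> R * R, (forall x, (lr x).1 <= (lr x).2) /\
    forall x y, e i x y <-> (lr x).2 < (lr y).1.
  move=> i; have [_ _ [lr le_lr elr]] := He i; exists lr; split=> // x y.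
  by rewrite elr left_ofE.
(* [inord] sends indices beyond [n] to 0, so the padding repeats the first member. *)
exists (fun k => lr (inord k)); split=> [k x|x y]; first by case: (Hlr (inord k)).
rewrite ltE; split=> [H k _|H i]; first by apply/(Hlr _).2.
by apply/(Hlr _).2; rewrite -[i]inord_val; apply: H; apply: leq_trans nd.
Qed.

End IntervalOrders.

Lemma cmp_adjE disp (P : finPOrderType disp) (x y : P) :
  cmp_adj x y = (x < y)%O || (y < x)%O.
Proof. by rewrite /cmp_adj /Order.comparable !lt_def eq_sym; case: eqP. Qed.

Lemma poset_of_nat_intervals (R : realType) (T : finType) d (l r : 'I_d -> T -> nat) :
    0 < d -> (forall k x, l k x <= r k x) ->
  exists (disp : Order.disp_t) (P : finPOrderType disp), interval_dim_le R P d /\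
    exists2 f : T -> P, bijective f &
      forall x y, (f x < f y)%O = [forall k, r k x < l k y].
Proof.
move=> d_gt0 lr; pose lt x y := [forall k, r k x < l k y].
have lt_irr : irreflexive lt.
  by move=> x; apply/negP => /forallP/(_ (Ordinal d_gt0)); rewrite ltnNge lr.
have lt_trans : transitive lt.
  move=> y x z /forallP xy /forallP yz; apply/forallP => k.
  by apply: leq_trans (xy k) (leq_trans (lr k y) (ltnW (yz k))).
pose M := Order.Lt_isPOrder.Build (Order.Disp tt tt) T lt_irr lt_trans.
pose P : finPOrderType (Order.Disp tt tt) := HB.pack T M.
exists (Order.Disp tt tt), P; split; last by exists (id : T -> P) => //; exists id.
apply: (@interval_dim_le_realizer _ _ _ _ (fun k (x y : P) => r k x < l k y)).
split=> [k|x y]; first exact: (@interval_order_nat R P).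
by split=> [/forallP|/forallP].
Qed.

(** * From words to posets *)

Section Positions.
Variables (A : eqType) (w : seq A).
Implicit Type a : A.

(* The length of the shortest prefix with [j] occurrences of [a].              *)
Definition position a j : nat :=
  find (fun i => j <= count_mem a (take i w)) (iota 0 (size w)).

Lemma count_take_le a i j : i <= j -> count_mem a (take i w) <= count_mem a (take j w).
Proof. by move=> ij; rewrite -[take j w](cat_take_drop i) take_takel // count_cat leq_addr. Qed.

Lemma position_le_size a j : position a j <= size w.
Proof. by rewrite -[leqRHS](size_iota 0) find_size. Qed.

(** A Galois connection: prefix counts are monotone in the length, so comparing counts amounts to
    comparing positions. *)
Lemma position_le a j i : j <= count_mem a w ->
  (position a j <= i) = (j <= count_mem a (take i w)).
Proof.
move=> jw; apply/idP/idP => [le_pi|]; last apply: contraTT; rewrite -?ltnNge.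
  apply: leq_trans (count_take_le a le_pi).
  (* A failed search returns [size w], the whole word, where [jw] applies. *)
  have [lt_pw|] := ltnP (position a j) (size w); last by move/take_oversize->.
  have := lt_pw; rewrite -[X in _ < X](size_iota 0) -has_find => /(nth_find 0).
  by rewrite nth_iota.
move=> lt_ip; have lt_iw := leq_trans lt_ip (position_le_size a j).
by have := before_find 0 lt_ip; rewrite nth_iota // add0n ltnNge => ->.
Qed.

Lemma precedes_position k a b :
    2 * k.+1 <= count_mem a w -> 2 * k.+1 <= count_mem b w ->
  precedes k a b w <-> position a (2 * k.+1) < position b (2 * k).+1.
Proof.
move=> wa wb; have wb1 : (2 * k).+1 <= count_mem b w by lia.
split=> [[i [ia ib]]|ab]; last exists (position a (2 * k.+1)).
  apply: (@leq_ltn_trans i); first by rewrite position_le.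
  by rewrite ltnNge position_le // -ltnNge.
by rewrite -position_le //; split=> //; rewrite leqNgt -position_le // -ltnNge.
Qed.

End Positions.

(* A letter without exactly [2d] occurrences is an isolated vertex; it gets    *)
(* the interval [[0, size w]], which meets all the others.                     *)
Lemma word_graph_comparability (R : realType) d (A : finType) (w : seq A) :
    0 < d ->
  exists (disp : Order.disp_t) (P : finPOrderType disp),
    interval_dim_le R P d /\ giso (word_graph (L_idim d) w) (comparability_graph P).
Proof.
move=> d_gt0; pose good x := count_mem x w == 2 * d.
pose l (k : 'I_d) (x : seq_sub w) :=
  if good (val x) then position w (val x) (2 * k).+1 else 0.
pose r (k : 'I_d) (x : seq_sub w) :=
  if good (val x) then position w (val x) (2 * k.+1) else size w.
have lr k x : l k x <= r k x.
  rewrite /l /r /good; case: eqP => // wx.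
  have kd := ltn_ord k; rewrite position_le ?wx; last by lia.
  apply: (@leq_trans (2 * k.+1)); first by lia.
  by rewrite -position_le ?wx //; lia.
have [disp [P [dimP [f f_bij fE]]]] := poset_of_nat_intervals R d_gt0 lr.
exists disp, P; split=> //; exists f => // x y /=.
rewrite cmp_adjE !fE /word_adj; case: eqVneq => [->|xy] /=.
  rewrite orbb; apply/negbTE/negP => /forallP/(_ (Ordinal d_gt0)).
  by rewrite ltnNge lr.
(* No left endpoint exceeds [size w], and no right endpoint is below 0. *)
have bad_l u v : ~~ good (val u) || ~~ good (val v) -> [forall k, r k u < l k v] = false.
  move=> bad; apply/negbTE/negP => /forallP/(_ (Ordinal d_gt0)).
  rewrite /l /r; move: bad; case: (good (val u)) => /=; case: (good (val v)) => //= _.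
  by rewrite ltnNge position_le_size.
have lt_prec u v : good (val u) -> good (val v) ->
    [forall k, r k u < l k v] <-> forall k, k < d -> precedes k (val u) (val v) w.
  move=> gu gv; split=> [/forallP H k kd|H]; last apply/forallP => k.
    have := H (Ordinal kd); rewrite /l /r gu gv /= -precedes_position //.
      by rewrite (eqP gu); lia.
    by rewrite (eqP gv); lia.
  have kd := ltn_ord k.
  rewrite /l /r gu gv; apply/precedes_position; rewrite ?(eqP gu) ?(eqP gv); [lia|lia|].
  exact: H.
have xy' : val x != val y by rewrite val_eqE.
case gx: (good (val x)); last first.
  rewrite !bad_l ?gx ?orbT //; apply/esym/negbTE/negP => /(h_proj_L_idim d w xy')[/eqP].
  by rewrite -/(good _) gx.
case gy: (good (val y)); last first.
  rewrite !bad_l ?gy ?orbT //; apply/esym/negbTE/negP => /(h_proj_L_idim d w xy')[_ /eqP].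
  by rewrite -/(good _) gy.
apply/orP/idP => [H|/(h_proj_L_idim d w xy')[_ _ H]].
  apply/h_proj_L_idim => //; split; [exact/eqP|exact/eqP|].
  by case: H => /lt_prec H; [left|right]; apply: H.
by case: H => H; [left|right]; apply/lt_prec.
Qed.

(** * From interval orders to words: one block *)

Section EndpointWord.
Variables (R : realType) (T : finType) (lr : T -> R * R).
Local Open Scope ring_scope.
Hypothesis lrP : forall x, (lr x).1 <= (lr x).2.
Implicit Types (u v x : T) (p q : T * bool).

(* [(x, false)] and [(x, true)] are the left and right endpoints of [x]; at    *)
(* equal values left endpoints come first, so that touching intervals overlap. *)
Definition endpoint_le p q : bool :=
  let value p := if p.2 then (lr p.1).2 else (lr p.1).1 in
  (value p < value q) || (value p == value q) && (p.2 ==> q.2).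

Lemma endpoint_le_total : total endpoint_le.
Proof. by move=> [x []] [y []]; rewrite /endpoint_le /=; case: ltgtP. Qed.

Lemma endpoint_le_trans : transitive endpoint_le.
Proof.
move=> q p r /orP[pq|/andP[/eqP pq bpq]] /orP[qr|/andP[/eqP qr bqr]];
  rewrite /endpoint_le.
- by rewrite (lt_trans pq qr).
- by rewrite -qr pq.
- by rewrite pq qr.
by rewrite pq qr eqxx /=; apply/orP; right; apply/implyP => /(implyP bpq)/(implyP bqr).
Qed.

Definition endpoints : seq (T * bool) := sort endpoint_le (enum {: T * bool}).

Definition endpoint_word : seq T := [seq p.1 | p <- endpoints].

Lemma endpoints_uniq : uniq endpoints.
Proof. by rewrite sort_uniq enum_uniq. Qed.

Lemma mem_endpoints p : p \in endpoints.
Proof. by rewrite mem_sort mem_enum. Qed.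

Lemma endpoint_le_take_drop i p q :
  p \in take i endpoints -> q \in drop i endpoints -> endpoint_le p q.
Proof.
have := sort_sorted endpoint_le_total (enum {: T * bool}).
rewrite (sorted_pairwise endpoint_le_trans) -/endpoints -{1}(cat_take_drop i endpoints).
by rewrite pairwise_cat => /andP[/allrelP H _]; apply: H.
Qed.

Lemma count_endpoints x s : uniq s ->
  count_mem x [seq p.1 | p : T * bool <- s] = (((x, false) \in s) + ((x, true) \in s))%N.
Proof.
elim: s => //= -[y b] s IH /andP[ys /IH ->]; rewrite !inE !xpair_eqE /= [x == y]eq_sym.
case: eqVneq ys => //= -> ; case: b => /negbTE -> /=; lia.
Qed.

Lemma count_endpoint_word x : count_mem x endpoint_word = 2%N.
Proof. by rewrite count_endpoints ?endpoints_uniq // !mem_endpoints. Qed.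

(** Such a prefix contains the right endpoint of [u] but not the left endpoint of [v]; the tie rule
    makes the resulting inequality strict. Conversely, the cut is made just before the left endpoint
    of [v]. *)
Lemma endpoint_word_prefix u v :
  (exists i, (2 <= count_mem u (take i endpoint_word))%N /\
             count_mem v (take i endpoint_word) = 0%N) <->
  (lr u).2 < (lr v).1.
Proof.
have count_take x i : count_mem x (take i endpoint_word) =
    (((x, false) \in take i endpoints) + ((x, true) \in take i endpoints))%N.
  by rewrite -map_take count_endpoints // take_uniq // endpoints_uniq.
have mem_drop i p : (p \in drop i endpoints) = (p \notin take i endpoints).
  have := mem_endpoints p; rewrite -{1}(cat_take_drop i endpoints) mem_cat.
  have := endpoints_uniq; rewrite -{1}(cat_take_drop i endpoints) cat_uniq.
  case/and3P=> _ /hasPn disj _.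
  case: (boolP (p \in drop i endpoints)) => [/disj/= ->//|_]; by rewrite orbF => ->.
split=> [[i]|lt_uv].
  rewrite !count_take => -[u2 v0].
  have ut : (u, true) \in take i endpoints by move: u2; case: (_ \in _); case: (_ \in _).
  have vd : (v, false) \in drop i endpoints by rewrite mem_drop; move: v0; case: (_ \in _).
  by have := endpoint_le_take_drop ut vd; rewrite /endpoint_le /= andbF orbF.
pose i := index (v, false) endpoints; exists i; rewrite !count_take.
have vf : (v, false) \in drop i endpoints.
  by rewrite mem_drop in_take ?mem_endpoints // ltnn.
have ub b : (u, b) \in take i endpoints.
  rewrite -[_ \in _]negbK -mem_drop; apply/negP => ub.
  have val_ub : (if b then (lr u).2 else (lr u).1) < (lr v).1.
    by case: b {ub} => //; apply: le_lt_trans lt_uv.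
  move: ub; rewrite drop_index ?mem_endpoints // inE => /predU1P[[uv b0]|ub].
    by move: val_ub; rewrite uv b0 ltxx.
  have vt : (v, false) \in take i.+1 endpoints by rewrite in_take ?mem_endpoints ?ltnS.
  have := endpoint_le_take_drop vt ub; rewrite /endpoint_le /= andbT.
  by rewrite orbC -le_eqVlt leNgt val_ub.
rewrite !ub; split=> //; move: (vf); rewrite mem_drop => /negbTE ->.
(* The right endpoint of [v] before its left one would contradict [lrP]. *)
case: (boolP ((v, true) \in _)) => // vt.
have := endpoint_le_take_drop vt vf; rewrite /endpoint_le /= andbF orbF.
by rewrite ltNge lrP.
Qed.

End EndpointWord.

(** * Concatenation of the blocks *)

Section Concatenation.
Variables (A : eqType) (W : nat -> seq A).
Hypothesis count_W : forall k x, count_mem x (W k) = 2.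

Definition block_word d : seq A := flatten [seq W k | k <- iota 0 d].

Lemma count_blocks m n x : count_mem x (flatten [seq W k | k <- iota m n]) = 2 * n.
Proof.
elim: n m => [|n IH] m; first by rewrite muln0.
by rewrite /= count_cat IH count_W mulnS.
Qed.

(** The first [k] blocks contribute [2 * k] occurrences of each letter, which lowers the thresholds
    to 2 and 0. A cut before block [k] has too few [u], one after it too many [v]. *)
Lemma precedes_block_word d k u v : k < d ->
  precedes k u v (block_word d) <->
  exists i, 2 <= count_mem u (take i (W k)) /\ count_mem v (take i (W k)) = 0.
Proof.
move=> kd; rewrite /block_word -(subnKC kd) -addn1 -addnA iotaD map_cat flatten_cat add0n.
rewrite add1n [iota k _]/= [map _ (k :: _)]/= [flatten (_ :: _)]/=.
set pre := flatten _; set post := flatten _.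
have pre_u x : count_mem x pre = 2 * k by apply: count_blocks.
have W_u x := count_W k x.
split=> [] [i]; last first.
  move=> [iu iv]; exists (size pre + minn i (size (W k))).
  rewrite takeD take_size_cat // drop_size_cat // takel_cat ?geq_minr // !count_cat !pre_u.
  have -> : take (minn i (size (W k))) (W k) = take i (W k).
    by case: (leqP i (size (W k))) => // /ltnW le_wi; rewrite take_size take_oversize.
  lia.
rewrite take_cat; case: ltnP => [lt_i|_].
  by have := count_take_le pre u (ltnW lt_i); rewrite take_size pre_u; lia.
rewrite !count_cat !pre_u take_cat.
case: ltnP => [lt_i|_] [iu iv]; first by exists (i - size pre); lia.
by move: iv; rewrite count_cat W_u; lia.
Qed.

End Concatenation.

Lemma comparability_word_graph (R : realType) d disp (P : finPOrderType disp) :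
    0 < d -> interval_dim_le R P d -> graph_class (L_idim d) (comparability_graph P).
Proof.
move=> d_gt0 /interval_dim_le_endpoints[lr [lrP ltE]].
pose w := block_word (fun k => endpoint_word (lr k)) d.
have count_w x : count_mem x w = 2 * d.
  by apply: count_blocks => k y; apply: count_endpoint_word.
have lt_prec x y : (x < y)%O <-> forall k, k < d -> precedes k x y w.
  rewrite ltE; split=> H k kd; have := H k kd;
    by rewrite precedes_block_word ?endpoint_word_prefix // => j z; apply: count_endpoint_word.
(* As [d] is positive, every element of [P] occurs in [w] and is a vertex. *)
have w_mem x : x \in w by rewrite -has_pred1 has_count count_w muln_gt0.
exists P, w; exists (fun x => SeqSub (w_mem x)).
  by exists val => // -[x xw]; apply: val_inj.
move=> x y /=; rewrite cmp_adjE /word_adj -val_eqE /=.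
case: eqVneq => [->|xy] /=; first by rewrite ltxx.
apply/idP/orP => [/(h_proj_L_idim d w xy)[_ _ H]|H].
  by case: H => /lt_prec; [left|right].
by apply/h_proj_L_idim => //; split=> //; case: H => /lt_prec; [left|right].
Qed.

Lemma giso_trans G H K : giso G H -> giso H K -> giso G K.
Proof.
move=> [f f_bij fE] [g g_bij gE]; exists (g \o f); first exact: bij_comp.
by move=> x y /=; rewrite gE fE.
Qed.

Theorem theorem19 (R : realType) (d : nat) (hd : 1 <= d) :
  uniform_lang (2 * d) (L_idim d) /\
  forall G : sgraph,
    graph_class (L_idim d) G <->
    exists (disp : Order.disp_t) (P : finPOrderType disp),
      interval_dim_le R P d /\ giso G (comparability_graph P).
Proof.
split=> [w /and3P[w0 w1 _]|G]; first by rewrite /uniform w0.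
split=> [[A [w Gw]]|[disp [P [dimP GP]]]].
  have [disp [P [dimP wP]]] := word_graph_comparability R w hd.
  by exists disp, P; split=> //; apply: giso_trans wP.
have [A [w Pw]] := comparability_word_graph hd dimP.
by exists A, w; apply: giso_trans Pw.
Qed.
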